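(* Fix $\beta\in(0,1)$ and let $p=p(N)\in(0,1]$ be such that $p^3N^2\to\infty$ as $N\to\infty$. Then, for every non-negative bounded continuous function $g:\mathbb R\to\mathbb R$ with $g\not\equiv0$, $$\frac{Z_N(\beta,g)}{\mathbb E Z_N(\beta,g)}\to1\qquad (N\to\infty)$$ in $L^2$ and, hence, in probability.
   Context: For each $N\in\mathbb N$ let $p=p(N)\in(0,1]$ and let $(\varepsilon_{i,j})_{i,j=1}^N$ be independent random variables on a probability space with probability measure $\mathbb P$, with $\mathbb P[\varepsilon_{i,j}=1]=p$ and $\mathbb P[\varepsilon_{i,j}=0]=1-p$ (indicators of the directed edges, loops allowed, of a directed Erdős–Rényi random graph on $\{1,\dots,N\}$). $\mathbb E$ denotes expectation with respect to $\mathbb P$, i.e. with respect to the randomness of $(\varepsilon_{i,j})$. The Hamiltonian is, for $\sigma\in\{-1,+1\}^N$, $$H(\sigma)=H_N(\sigma)=-\frac1{2Np}\sum_{i,j=1}^N\varepsilon_{i,j}\sigma_i\sigma_j.$$ For a bounded continuous function $g:\mathbb R\to\mathbb R$ the generalized partition function is $$Z_N(\beta,g)=\sum_{\sigma\in\{-1,+1\}^N}e^{-\beta H(\sigma)}\,g\left(\frac{\sum_{i=1}^N\sigma_i}{\sqrt N}\right).$$ *)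

(* Defs.v *)
From HB Require Import structures.
From mathcomp Require Import all_boot all_order all_algebra.
From mathcomp Require Import all_classical all_reals all_analysis.

Set Implicit Arguments.
Unset Strict Implicit.
Unset Printing Implicit Defensive.

Import Order.TTheory GRing.Theory Num.Theory.
Import numFieldNormedType.Exports.

Local Open Scope classical_set_scope.
Local Open Scope ring_scope.

(* A configuration in {-1,+1}^N is a boolean vector s; its i-th spin is
   (-1)^(s i), so [false] stands for +1 and [true] for -1. *)
Definition spin (R : realType) (N : nat) (s : {ffun 'I_N -> bool}) (i : 'I_N)
    : R :=
  (-1) ^+ s i.

(* The argument e is a realization of the edge indicators. *)
Definition hamiltonian (R : realType) (N : nat) (p : R)
    (e : 'I_N -> 'I_N -> R) (s : {ffun 'I_N -> bool}) : R :=
  - (2 * N%:R * p)^-1 *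
    \sum_(i < N) \sum_(j < N) e i j * spin R s i * spin R s j.

Definition partition_function (R : realType) (N : nat) (p beta : R)
    (g : R -> R) (e : 'I_N -> 'I_N -> R) : R :=
  \sum_(s : {ffun 'I_N -> bool})
    expR (- beta * hamiltonian p e s) *
    g ((\sum_(i < N) spin R s i) / Num.sqrt N%:R).

Definition mutually_independent (R : realType) (d : measure_display)
    (T : measurableType d) (P : probability T R) (I : finType)
    (X : I -> {RV P >-> R}) : Prop :=
  forall (J : {set I}) (B : I -> set R), (forall i, measurable (B i)) ->
    P (\bigcap_(i in [set` J]) (X i @^-1` B i)) =
    (\prod_(i in J) P (X i @^-1` B i))%E.

(* In the two modes of convergence below, the N-th function lives on its own
   probability space (T N, P N) and the limit is the constant c. *)
Definition cvg_in_L2 (R : realType) (d : nat -> measure_display)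
    (T : forall N, measurableType (d N)) (P : forall N, probability (T N) R)
    (X : forall N, T N -> R) (c : R) : Prop :=
  (forall N, X N \in Lfun (P N) 2%:E) /\
  Lnorm (P N) 2%:E (fun w => (X N w - c)%:E) @[N --> \oo] --> 0%E.

Definition cvg_in_probability (R : realType) (d : nat -> measure_display)
    (T : forall N, measurableType (d N)) (P : forall N, probability (T N) R)
    (X : forall N, T N -> R) (c : R) : Prop :=
  (forall N, measurable_fun setT (X N)) /\
  forall delta : R, 0 < delta ->
    P N [set w | delta < `|X N w - c|] @[N --> \oo] --> 0%E.

(* Main.v *)
(** Write [gam = beta / (2 N p)] and let [L] be the cumulant generating function
    of one edge.  Independence of the edges gives [E Z] and [E Z^2] in closed
    form: with [S] the total spin, [E Z] is [e^(N^2 a0)] times a sum over [s]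
    of [e^(a1 S(s)^2) g], and [E Z^2] is [e^(N^2 c0)] times a sum over pairs
    [(s, t)] of [e^(c1 (S(s)^2 + S(t)^2) + c0 S(s t)^2) g g], where
    [a0, a1, c0, c1] are combinations of [L (+- gam)] and [L (+- 2 gam)].
    The condition [p^3 N^2 -> oo] is what makes [N^2 (c0 - 2 a0)] vanish, while
    [N (c1 - a1)] and [N c0] vanish as soon as [N p -> oo].  Since
    [N a1 -> beta / 2 < 1 / 2], uniform bounds on [E e^(theta S^2 / N)],
    [theta < 1 / 2], show that [E Z^2] exceeds [(E Z)^2] by at most
    [o(1) * 4^N e^(2 N^2 a0)].  On the other side, [E Z] is at least of order
    [2^N e^(N^2 a0)]: binomial coefficients are comparable to each other in a
    window of width [O(sqrt N)] around [N / 2], which carries most of the mass,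
    so [S / sqrt N] meets every fixed interval with probability bounded below. *)

Require Import Defs.
From HB Require Import structures.
From mathcomp Require Import all_boot all_order all_algebra.
From mathcomp Require Import all_classical all_reals all_analysis.
From mathcomp Require Import measurable_realfun ring lra.
Set Implicit Arguments.
Unset Strict Implicit.
Unset Printing Implicit Defensive.
Import Order.TTheory GRing.Theory Num.Theory.
Import numFieldNormedType.Exports.
Local Open Scope classical_set_scope.
Local Open Scope ring_scope.

(** * Sums over spin configurations *)

Lemma ger0_is_derive_le (R : realType) (f df : R -> R) (x : R) :
  (forall y : R, is_derive y 1 f (df y)) -> (forall y, 0 <= y -> 0 <= df y) ->
  0 <= x -> f 0 <= f x.
Proof.
move=> fdf df0; rewrite le_eqVlt => /predU1P[<-//|x0].
have cf : {within `[0, x], continuous f}.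
  apply/continuous_subspaceT => y.
  by apply/differentiable_continuous/derivable1_diffP; case: (fdf y).
have [c] := @MVT R f df 0 x x0 (fun y _ => fdf y) cf.
rewrite in_itv/= => /andP[c0 cx] fE.
by rewrite -subr_ge0 fE subr0 mulr_ge0 ?df0 ?ltW.
Qed.

Lemma is_derive_expRN (R : realType) (y : R) :
  is_derive y 1 (fun z : R => expR (- z)) (- expR (- y)).
Proof.
by apply: is_derive_eq; rewrite mulrN1.
Qed.

(** The function [2 cosh y * e^(- y^2 / 2)] is non-increasing for [y >= 0]: its derivative is
    [- k y * e^(- y^2 / 2)], where [k 0 = 0] and [k' y = 2 y sinh y >= 0]. Its negative is [m]. *)
Lemma expR_cosh_le (R : realType) (x : R) :
  expR x + expR (- x) <= 2 * expR (x ^+ 2 / 2).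
Proof.
wlog x0 : x / 0 <= x.
  move=> H; have [/H//|/ltW x0] := leP 0 x.
  by rewrite addrC -{2}(opprK x) -sqrrN; apply: H; rewrite oppr_ge0.
pose k (y : R) := y * (expR y + expR (- y)) - (expR y - expR (- y)).
have k0 (y : R) : 0 <= y -> 0 <= k y.
  move=> y0; rewrite -[leLHS](_ : k 0 = _); last first.
    by rewrite /k oppr0 subrr mul0r subrr.
  apply: (@ger0_is_derive_le _ _ (fun y => y * (expR y - expR (- y)))) => //.
    move=> z; have hN := is_derive_expRN z.
    apply: is_derive_eq.
    rewrite /= /GRing.scale/=; ring.
  move=> z z0; rewrite mulr_ge0// subr_ge0 ler_expR; lra.
pose m (y : R) := - ((expR y + expR (- y)) * expR (- (y ^+ 2 / 2))).
have dq (z : R) : is_derive z 1 (fun y : R => expR (- (y ^+ 2 / 2)))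
    (- z * expR (- (z ^+ 2 / 2))).
  have h1 : is_derive z 1 (fun y : R => - (y ^+ 2 / 2)) (- z).
    apply: is_derive_eq.
    rewrite /= /GRing.scale/= mulr0; by field.
  have h := @is_derive1_comp R expR (fun y => - (y ^+ 2 / 2)) z _ _ (is_derive_expR _) h1.
  by apply: (is_derive_eq h); rewrite mulrC.
have : m 0 <= m x.
  apply: (@ger0_is_derive_le _ _ (fun y => k y * expR (- (y ^+ 2 / 2)))) => //.
    move=> z; have hN := is_derive_expRN z; have hq := dq z.
    apply: is_derive_eq.
    rewrite /= /k /GRing.scale/=; ring.
  by move=> z z0; rewrite mulr_ge0 ?k0 ?expR_ge0.
by rewrite /m expr0n/= mul0r !oppr0 !expR0 lerN2 mulr1 [expR (- (_ / _))]expRN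
  ler_pdivrMr ?expR_gt0.
Qed.

(** Twice the transition operator of simple random walk. Without the factor 1/2, the [N]-th iterate
    at 0 is a sum over all configurations rather than an average. *)
Definition walk_step (R : realType) (f : R -> R) (y : R) : R :=
  f (y + 1) + f (y - 1).

(** Induction by Pascal's rule; [k] counts the steps down. *)
Lemma iter_walk_step (R : realType) n (f : R -> R) (y : R) :
  iter n (@walk_step R) f y =
  \sum_(0 <= k < n.+1) 'C(n, k)%:R * f (y + n%:R - 2 * k%:R).
Proof.
elim: n f y => [|n IH] f y.
  by rewrite /= big_nat1 bin0 mul1r; congr f; ring.
rewrite iterS /walk_step !IH.
rewrite [RHS]big_nat_recl//= bin0 mul1r.
under [in RHS]eq_bigr do rewrite binS natrD mulrDl.
rewrite big_split/= addrA; congr +%R.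
  rewrite [in RHS]big_nat_recr//= bin_small// mul0r addr0.
  rewrite big_nat_recl//= bin0 mul1r; congr +%R.
    by congr f; rewrite -natr1; ring.
  by apply: eq_bigr => i _; congr (_ * f _); rewrite -!natr1; ring.
by apply: eq_bigr => i _; congr (_ * f _); rewrite -!natr1; ring.
Qed.

Lemma sum_spinE (R : realType) N (s : {ffun 'I_N -> bool}) :
  \sum_(i < N) spin R s i = N%:R - 2 * #|[set i | s i]%SET|%:R.
Proof.
rewrite -sum1_card natr_sum mulr_sumr [X in _ - X]big_mkcond/=.
have -> : N%:R = \sum_(i < N) 1 :> R by rewrite sumr_const card_ord.
rewrite -sumrB.
apply: eq_bigr => i _; rewrite inE /spin.
by case: (s i); rewrite /= ?expr1 ?expr0 ; ring.
Qed.

(** Configurations are grouped by their number of spins -1. Sending [s] to the set of these sites is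
    a bijection onto the subsets of the sites. *)
Lemma sum_over_spins (R : realType) N (F : R -> R) :
  \sum_(s : {ffun 'I_N -> bool}) F (\sum_(i < N) spin R s i) =
  \sum_(0 <= k < N.+1) 'C(N, k)%:R * F (N%:R - 2 * k%:R).
Proof.
rewrite big_mkord.
pose c (s : {ffun 'I_N -> bool}) : 'I_N.+1 := inord #|[set i | s i]%SET|.
rewrite (partition_big c xpredT)//=.
have cE s : c s = #|[set i | s i]%SET| :> nat.
  by rewrite inordK// ltnS -[X in (_ <= X)%N]card_ord max_card.
apply: eq_bigr => k _.
transitivity (\sum_(s | c s == k) F (N%:R - 2 * k%:R)).
  by apply: eq_bigr => s /eqP <-; rewrite sum_spinE cE.
rewrite sumr_const -[LHS]mulr_natl; congr (_%:R * _).
transitivity #|[set A : {set 'I_N} | #|A| == k]%SET|; last by rewrite card_draws card_ord.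
rewrite -(@card_imset _ _ (fun s : {ffun 'I_N -> bool} => [set i | s i]%SET)).
  apply: eq_card => A; rewrite inE; apply/imsetP/eqP.
    by move=> [s] /eqP sk ->; rewrite -cE sk.
  move=> Ak; exists [ffun i => i \in A].
    change (nat_of_ord (c [ffun i => i \in A]) == k :> nat).
    rewrite cE -Ak; apply/eqP.
    by apply: eq_card => i; rewrite inE ffunE.
  by apply/setP => i; rewrite inE ffunE.
move=> s t /setP st; apply/ffunP => i; by have := st i; rewrite !inE.
Qed.

Lemma sum_spins_walk (R : realType) N (F : R -> R) :
  \sum_(s : {ffun 'I_N -> bool}) F (\sum_(i < N) spin R s i) =
  iter N (@walk_step R) F 0.
Proof. by rewrite sum_over_spins iter_walk_step add0r. Qed.

Lemma walk_le (R : realType) n (f h : R -> R) (y : R) :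
  (forall z, f z <= h z) -> iter n (@walk_step R) f y <= iter n (@walk_step R) h y.
Proof.
move=> fh; rewrite !iter_walk_step; apply: ler_sum => k _.
by rewrite ler_wpM2l.
Qed.

Lemma walkZ (R : realType) n (c : R) (f : R -> R) (y : R) :
  iter n (@walk_step R) (fun z => c * f z) y = c * iter n (@walk_step R) f y.
Proof.
rewrite !iter_walk_step mulr_sumr; apply: eq_bigr => k _.
by rewrite mulrCA.
Qed.

Lemma walk_cst (R : realType) n (c : R) (y : R) :
  iter n (@walk_step R) (fun=> c) y = 2 ^+ n * c.
Proof.
by elim: n y => [|n IH] y; rewrite ?mul1r// iterS /walk_step !IH exprS; ring.
Qed.

Lemma walk_sqr (R : realType) n (y : R) :
  iter n (@walk_step R) (fun z => z ^+ 2) y = 2 ^+ n * (y ^+ 2 + n%:R).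
Proof.
elim: n y => [|n IH] y; first by rewrite mul1r addr0.
by rewrite iterS /walk_step !IH [in RHS]exprS -natr1; ring.
Qed.

(* One step turns [b] into at most [b + 2 b ^ 2 <= b / (1 - 2 b)], a map that
   shifts [1 / b] by [-2]. *)
Lemma walk_exp_sqr (R : realType) n (b : R) :
  0 <= b -> 2 * n%:R * b < 1 ->
  iter n (@walk_step R) (fun z => expR (b * z ^+ 2)) 0 <=
  2 ^+ n * expR (n%:R * b / (1 - 2 * n%:R * b)).
Proof.
elim: n b => [|n IH] b b0 nb.
  by rewrite /= expr0n/= mulr0 !mul0r !expR0 mulr1.
rewrite iterSr; set c := b / (1 - 2 * b).
have nb0 : 0 <= n%:R * b by rewrite mulr_ge0.
rewrite -natr1 in nb.
have b1 : 0 < 1 - 2 * b by nra.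
have c0 : 0 <= c by rewrite divr_ge0// ltW.
have bc : b + 2 * b ^+ 2 <= c.
  rewrite /c ler_pdivlMr//; nra.
have nc : 1 - 2 * n%:R * c = (1 - 2 * (n%:R + 1) * b) / (1 - 2 * b).
  by rewrite /c; field; rewrite gt_eqF.
have nc1 : 2 * n%:R * c < 1.
  by rewrite -subr_gt0 nc divr_gt0//; lra.
apply: (@le_trans _ _
  (2 * expR b * iter n (@walk_step R) (fun z => expR (c * z ^+ 2)) 0)).
  rewrite -walkZ; apply: walk_le => z; rewrite /walk_step.
  have -> : b * (z + 1) ^+ 2 = b + b * z ^+ 2 + 2 * b * z by ring.
  have -> : b * (z - 1) ^+ 2 = b + b * z ^+ 2 + - (2 * b * z) by ring.
  rewrite !(expRD (b + _)) -mulrDr.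
  apply: le_trans (_ : expR (b + b * z ^+ 2) * (2 * expR ((2 * b * z) ^+ 2 / 2)) <= _).
    by rewrite ler_pM2l ?expR_gt0// expR_cosh_le.
  rewrite mulrCA mulrA -mulrA -expRD -[leRHS]mulrA -expRD ler_pM2l// ler_expR.
  have : 0 <= z ^+ 2 by exact: sqr_ge0.
  by move: bc; nra.
apply: le_trans (_ : 2 * expR b * (2 ^+ n * expR (n%:R * c / (1 - 2 * n%:R * c))) <= _).
  by rewrite ler_wpM2l ?mulr_ge0 ?expR_ge0// IH.
have -> : n%:R * c / (1 - 2 * n%:R * c) = n%:R * b / (1 - 2 * (n%:R + 1) * b).
  by rewrite nc /c; field; rewrite !gt_eqF//; lra.
rewrite [2 ^+ n.+1]exprS mulrACA -expRD ler_pM2l ?mulr_gt0 ?exprn_gt0//.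
rewrite -[n.+1%:R]natr1.
have D0 : 0 < 1 - 2 * (n%:R + 1) * b by lra.
(* As [D <= 1], the factor [e^b] produced by one step is at most [e^(b / D)], which is the summand
   still missing in the exponent. *)
have D1 : 1 - 2 * (n%:R + 1) * b <= 1 by nra.
move: D0 D1; set D := 1 - _ => D0 D1.
rewrite ler_expR (mulrDl _ _ b) mul1r (mulrDl _ b) addrC lerD2l ler_pdivlMr//.
by rewrite ler_piMr.
Qed.

(** * Integer counts and central binomial coefficients *)

Lemma natr_count_ge (R : realType) n (a b : R) : 0 <= a ->
  Num.min n%:R b - a - 1 <= \sum_(0 <= k < n) (if a <= k%:R <= b then 1 else 0).
Proof.
move=> a0; elim: n => [|n IH].
  by rewrite big_nil; have [] := leP 0 b; lra.
rewrite big_nat_recr//=; move: IH; rewrite -natr1.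
have := ler0n R n.
case: ifP => [/andP[an nb]|/negbT]; last rewrite negb_and -!ltNge => /orP[].
- rewrite (min_idPl nb) => _ IH; have [] := leP (n%:R + 1) b; lra.
- move=> na n0 _.
  apply: le_trans (_ : 0 <= _); last by rewrite addr0 sumr_ge0// => k _; case: ifP.
  by have [] := leP (n%:R + 1) b; lra.
- move=> nb n0; rewrite (min_idPr (ltW nb)) (min_idPr _); first lra.
  by lra.
Qed.

Lemma natr_count_le (R : realType) n (a b : R) : a <= b ->
  \sum_(0 <= k < n) (if a <= k%:R <= b then 1 else 0) <= b - a + 1.
Proof.
move=> ab.
(* Truncation at [n] makes the bound inductive: a new index in [[a, b]] raises the right-hand side
   by exactly 1. *)
suff : \sum_(0 <= k < n) (if a <= k%:R <= b then 1 else 0) <=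
    Num.max 0 (Num.min n%:R (b + 1) - a).
  move/le_trans; apply; rewrite ge_max; apply/andP; split; first lra.
  by have [] := leP n%:R (b + 1); lra.
elim: n => [|n IH].
  by rewrite big_nil le_max lexx.
rewrite big_nat_recr//=; move: IH; rewrite -natr1.
set s := \sum_(_ <= _ < _) _; move: s => s.
case: ifP => [/andP[an nb]|_].
  rewrite (min_idPl _); last lra.
  rewrite (min_idPl _); last lra.
  rewrite (max_idPr _); last lra.
  by rewrite (max_idPr _); lra.
rewrite addr0 => /le_trans; apply.
by rewrite ge_max !le_max lexx/=; apply/orP; right;
  rewrite lerD2r le_min !ge_min lexx orbT lerDl ler01.
Qed.

(** The ratio of consecutive coefficients is [(N - m) / (m + 1)]. For [A <= m] and [m + 1 <= N - A],
    both it and its inverse are at most [(N - A) / A]. *)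
Lemma bin_window (R : realType) (N k j : nat) (A : R) :
  0 < A -> A <= k%:R -> (k + j)%:R <= N%:R - A ->
  'C(N, k + j)%:R <= ((N%:R - A) / A) ^+ j * 'C(N, k)%:R :> R /\
  'C(N, k)%:R <= ((N%:R - A) / A) ^+ j * 'C(N, k + j)%:R :> R.
Proof.
move=> A0 Ak; set rho := (N%:R - A) / A.
elim: j => [|j IH] kjN; first by rewrite addn0 expr0 mul1r.
rewrite addnS -natr1 in kjN.
have [IH1 IH2] : 'C(N, k + j)%:R <= rho ^+ j * 'C(N, k)%:R /\
    'C(N, k)%:R <= rho ^+ j * 'C(N, k + j)%:R by apply: IH; lra.
have Akj : A <= (k + j)%:R by rewrite natrD (le_trans Ak)// lerDl.
have rho0 : 0 <= rho by rewrite divr_ge0//; lra.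
have kjN' : (k + j <= N)%N by rewrite -(ler_nat R); lra.
have e : ((k + j)%:R + 1) * 'C(N, (k + j).+1)%:R = (N%:R - (k + j)%:R) * 'C(N, k + j)%:R :> R.
  by rewrite natr1 -natrM mul_bin_left natrM natrB.
have c0 : 0 <= 'C(N, k + j)%:R :> R by [].
have c1 : 0 <= 'C(N, (k + j).+1)%:R :> R by [].
rewrite addnS; split.
- apply: (@le_trans _ _ (rho * 'C(N, k + j)%:R)).
    rewrite /rho mulrAC ler_pdivlMr//; nra.
  by rewrite exprS -mulrA ler_wpM2l.
- apply: (le_trans IH2); rewrite exprSr -mulrA ler_wpM2l ?exprn_ge0//.
  rewrite /rho mulrAC ler_pdivlMr//; nra.
Qed.

(** All coefficients with [|N - 2 k| <= C sqrt N] agree up to the factor [K = e^(4 C^2)], and by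
    Chebyshev they carry at least 3/4 of the mass [2^N]. Hence each is at least of order
    [2^N / sqrt N], and order [sqrt N] of them correspond to [[u, v]]. *)
Lemma sum_spins_window_ge (R : realType) (N : nat) (u v C : R) :
  2 <= C -> `|u| <= C -> `|v| <= C ->
  4 * C <= Num.sqrt N%:R -> 4 <= (v - u) * Num.sqrt N%:R ->
  3 * (v - u) / (32 * expR (4 * C ^+ 2) * C) * 2 ^+ N <=
  \sum_(s : {ffun 'I_N -> bool})
    (if u <= (\sum_(i < N) spin R s i) / Num.sqrt N%:R <= v then 1 else 0).
Proof.
set q := Num.sqrt N%:R => C2; rewrite !ler_norml => /andP[u1 u2] /andP[v1 v2] qC uvq.
have q0 : 0 < q by apply: lt_le_trans qC; lra.
have qN : q ^+ 2 = N%:R by rewrite sqr_sqrtr.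
rewrite (sum_over_spins N (fun x => if u <= x / q <= v then 1 else 0)).
set K := expR _; have K0 : 0 < K by exact: expR_gt0.
(* The window [A <= k <= N - A] is [|N - 2 k| <= C q]; its length is [C q]. *)
set A := (N%:R - C * q) / 2.
have A0 : 0 < A by rewrite /A -qN; nra.
have AN : N%:R <= 4 * A by rewrite /A -qN; nra.
have N0 : 0 < N%:R :> R by rewrite -qN exprn_gt0.
have rho1 : (N%:R - A) / A <= 1 + 4 * C / q.
  rewrite ler_pdivrMr// mulrDl mul1r.
  have : C * q <= 4 * C / q * A.
    have -> : 4 * C / q * A = C * (4 * A / q) by ring.
    rewrite ler_pM2l; last lra.
    by rewrite ler_pdivlMr// -expr2 qN.
  rewrite /A; lra.
(* Two indices of the window differ by at most [C q], and [(1 + 4 C / q)^j <= e^(4 C j / q)]. *)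
have rhoj (j : nat) : j%:R <= C * q -> ((N%:R - A) / A) ^+ j <= K.
  move=> jC; apply: (@le_trans _ _ (expR (4 * C / q) ^+ j)).
    rewrite lerXn2r ?nnegrE ?expR_ge0//.
      by rewrite divr_ge0 ?(ltW A0)// /A; nra.
    exact: le_trans rho1 (expR_ge1Dx _).
  rewrite -expRM_natl /K ler_expR.
  rewrite mulrA ler_pdivrMr//; nra.
have cmp (k k' : nat) : A <= k%:R <= N%:R - A -> A <= k'%:R <= N%:R - A ->
    'C(N, k)%:R <= K * 'C(N, k')%:R :> R.
  move=> /andP[k1 k2] /andP[k1' k2'].
  case: (leqP k k') => kk.
    have /rhoj Kj : (k' - k)%:R <= C * q by rewrite natrB//; move: k1; rewrite /A in k2' *; lra.
    have h : (k + (k' - k))%:R <= N%:R - A by rewrite subnKC.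
    have [_] := bin_window A0 k1 h.
    rewrite subnKC// => /le_trans; apply; exact: ler_wpM2r.
  have {}kk := ltnW kk.
  have /rhoj Kj : (k - k')%:R <= C * q by rewrite natrB//; move: k1'; rewrite /A in k2 *; lra.
  have h : (k' + (k - k'))%:R <= N%:R - A by rewrite subnKC.
  have [+ _] := bin_window A0 k1' h.
  rewrite subnKC// => /le_trans; apply; exact: ler_wpM2r.
(* The indicator of the window dominates [1 - S^2 / (C^2 N)], and [S] has variance [N]; the mass is
   therefore at least [1 - 1 / C^2 >= 3/4]. *)
have cheb : 3 / 4 * 2 ^+ N <=
    \sum_(0 <= k < N.+1) 'C(N, k)%:R * (if A <= k%:R <= N%:R - A then 1 else 0) :> R.
  have s1 := walk_cst N (1 : R) 0; have s2 := walk_sqr N (0 : R).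
  rewrite !iter_walk_step in s1 s2.
  apply: (@le_trans _ _ (\sum_(0 <= k < N.+1) 'C(N, k)%:R *
    (1 - (C ^+ 2 * N%:R)^-1 * (0 + N%:R - 2 * k%:R) ^+ 2))).
    under eq_bigr do rewrite mulrBr mulrCA.
    rewrite big_split/= sumrN -mulr_sumr s1 s2 expr0n/= add0r mulr1. 
    have -> : (C ^+ 2 * N%:R)^-1 * (2 ^+ N * N%:R) = 2 ^+ N * (C ^+ 2)^-1 :> R.
      by field; rewrite !gt_eqF//; lra.
    have : (C ^+ 2)^-1 <= 1 / 4.
      by rewrite -div1r ler_pdivrMr ?exprn_gt0//; nra.
    have : 0 <= 2 ^+ N :> R by rewrite exprn_ge0.
    nra.
  apply: ler_sum => k _; rewrite ler_wpM2l//.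
  have CN0 : 0 < C ^+ 2 * N%:R by rewrite mulr_gt0// exprn_gt0//; lra.
  case: ifPn => [_|].
    by rewrite gerBl mulr_ge0 ?sqr_ge0// invr_ge0 ltW.
  rewrite negb_and -!ltNge subr_le0 add0r => kA.
  rewrite ler_pdivlMl// mulr1 -qN -exprMn.
  rewrite -[leRHS]real_normK ?num_real// lerXn2r ?nnegrE//; first by nra.
  by rewrite ler_normr; move: kA => /orP[]; rewrite /A => kA; apply/orP; [left|right]; lra.
(* The window holds at most [C q + 1 <= 2 C q] integers, and none of their coefficients exceeds [K]
   times the given one. *)
have lowC (k : nat) : (N%:R - v * q) / 2 <= k%:R <= (N%:R - u * q) / 2 ->
    3 * 2 ^+ N / (8 * K * C * q) <= 'C(N, k)%:R.
  move=> /andP[k1 k2].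
  have kW : A <= k%:R <= N%:R - A by rewrite /A; apply/andP; split; nra.
  rewrite ler_pdivrMr ?mulr_gt0//; last lra.
  have := natr_count_le N.+1 (_ : A <= N%:R - A).
  have AA : A <= N%:R - A by rewrite /A; nra.
  move=> /(_ AA); set n := \sum_(_ <= _ < _) _ => cnt.
  have : 3 / 4 * 2 ^+ N <= K * 'C(N, k)%:R * n.
    apply: (le_trans cheb); rewrite mulr_sumr; apply: ler_sum => i _.
    case: ifP => iW; rewrite ?mulr1 ?mulr0//.
    exact: cmp.
  have : n <= 2 * C * q by apply: (le_trans cnt); rewrite /A; nra.
  move=> n2 h; have : K * 'C(N, k)%:R * n <= K * 'C(N, k)%:R * (2 * C * q).
    by rewrite ler_wpM2l// mulr_ge0// ltW.
  nra.
(* The count is at least [(v - u) q / 2 - 1], and [(v - u) q >= 4] absorbs the 1. *)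
have cntI : (v - u) * q / 4 <= \sum_(0 <= k < N.+1)
    (if (N%:R - v * q) / 2 <= k%:R <= (N%:R - u * q) / 2 then 1 else 0).
  have a0 : 0 <= (N%:R - v * q) / 2 by rewrite -qN; nra.
  apply: le_trans (natr_count_ge N.+1 _ a0).
  have bN : (N%:R - u * q) / 2 <= N.+1%:R.
    have : 0 <= (C + u) * q by rewrite mulr_ge0 ?(ltW q0)//; lra.
    have : 0 <= (q - 4 * C) * q by rewrite mulr_ge0 ?(ltW q0)//; lra.
    rewrite -natr1 -qN; nra.
  rewrite (min_idPr bN); lra.
apply: (@le_trans _ _ (\sum_(0 <= k < N.+1)
   3 * 2 ^+ N / (8 * K * C * q) *
     (if (N%:R - v * q) / 2 <= k%:R <= (N%:R - u * q) / 2 then 1 else 0))); last first.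
  apply: ler_sum => k _.
  have -> : (u <= (N%:R - 2 * k%:R) / q <= v) =
      ((N%:R - v * q) / 2 <= k%:R <= (N%:R - u * q) / 2).
    rewrite ler_pdivlMr// ler_pdivrMr// andbC; congr andb; apply/idP/idP; lra.
  by case: ifP => [/lowC|_]; rewrite ?mulr1 ?mulr0.
rewrite -mulr_sumr.
apply: le_trans (ler_wpM2l _ cntI); last first.
  by rewrite divr_ge0// ?mulr_ge0 ?exprn_ge0 ?(ltW K0) ?(ltW q0)//; lra.
rewrite le_eqVlt; apply/orP; left; apply/eqP; field.
by rewrite !gt_eqF//; lra.
Qed.

(** * The cumulant generating function of an edge *)

Definition edge_mgf (R : realType) (p x : R) : R := 1 - p + p * expR x.

Definition edge_cgf (R : realType) (p x : R) : R := ln (edge_mgf p x).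

(** From [e^(- x) >= 1 - x] and [(1 - x) (1 + x + 2 x^2) = 1 + x^2 (1 - 2 x) >= 1]. *)
Lemma expR_le_quadratic (R : realType) (x : R) :
  `|x| <= 1 / 2 -> expR x <= 1 + x + 2 * x ^+ 2.
Proof.
rewrite ler_norml => /andP[x1 x2].
rewrite -[x in expR x]opprK expRN -[leRHS]invrK lef_pV2 ?posrE ?expR_gt0//.
  apply: le_trans (expR_ge1Dx _); rewrite -div1r ler_pdivrMr; nra.
by rewrite invr_gt0; nra.
Qed.

Lemma edge_mgf_gt0 (R : realType) (p x : R) : 0 < p <= 1 -> 0 < edge_mgf p x.
Proof.
by move=> /andP[p0 p1]; rewrite /edge_mgf ltr_wpDl ?mulr_gt0 ?expR_gt0 ?subr_ge0.
Qed.

Lemma expR_edge_cgf (R : realType) (p x : R) :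
  0 < p <= 1 -> expR (edge_cgf p x) = edge_mgf p x.
Proof. by move=> p01; rewrite lnK// posrE edge_mgf_gt0. Qed.

Lemma edge_cgf0 (R : realType) (p : R) : edge_cgf p 0 = 0.
Proof. by rewrite /edge_cgf /edge_mgf expR0 mulr1 subrK ln1. Qed.

Lemma edge_cgf_le (R : realType) (p x : R) :
  0 < p <= 1 -> `|x| <= 1 / 2 -> edge_cgf p x <= p * x + 2 * p * x ^+ 2.
Proof.
move=> p01 x2; have /andP[p0 p1] := p01.
rewrite -ler_expR expR_edge_cgf//; apply: le_trans (expR_ge1Dx _).
have := expR_le_quadratic x2; rewrite /edge_mgf; nra.
Qed.

(** With [y] the left-hand side, [e^y <= 1 / (1 - y) <= 1 + p x], and [1 + p x] is at most
    [edge_mgf p x] by convexity of the exponential. *)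
Lemma edge_cgf_ge (R : realType) (p x : R) :
  0 < p <= 1 -> `|x| <= 1 / 2 -> p * x - 2 * p * x ^+ 2 <= edge_cgf p x.
Proof.
move=> p01; rewrite ler_norml => /andP[x1 x2]; have /andP[p0 p1] := p01.
have px : - p / 2 <= p * x.
  have : 0 <= p * (x + 1 / 2) by rewrite mulr_ge0 ?(ltW p0)//; lra.
  lra.
rewrite -ler_expR expR_edge_cgf//; set y := p * x - _.
apply: (@le_trans _ _ (1 + p * x)); last first.
  by rewrite /edge_mgf; have := expR_ge1Dx x; nra.
rewrite -[y]opprK expRN -[leRHS]invrK lef_pV2 ?posrE ?expR_gt0//; last first.
  by rewrite invr_gt0; lra.
apply: le_trans (expR_ge1Dx _); rewrite -div1r ler_pdivrMr; last lra.
have -> : (1 + - y) * (1 + p * x) = 1 + p * x ^+ 2 * (2 - p + 2 * (p * x)).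
  by rewrite /y; ring.
rewrite lerDl; apply: mulr_ge0; last lra.
by rewrite mulr_ge0 ?sqr_ge0 ?(ltW p0).
Qed.

Lemma edge_cgfB_ge0 (R : realType) (p x : R) : 0 < p <= 1 -> 0 <= x ->
  0 <= edge_cgf p x - edge_cgf p (- x).
Proof.
move=> p01 x0; rewrite subr_ge0 ler_ln ?posrE ?edge_mgf_gt0//.
rewrite /edge_mgf lerD2l ler_wpM2l ?ler_expR//; last lra.
by case/andP: p01 => /ltW.
Qed.

(* With [phi = edge_mgf p], [h = cosh x - 1] and [q = 2 p (1 - p)] one has
   [phi x * phi (- x) = 1 + q h] and
   [phi (2 x) * phi (- 2 x) = 1 + 4 q h + 2 q h ^ 2],
   so that the terms of order [x ^ 2] cancel. *)
Lemma edge_cgf_cancel (R : realType) (p x : R) : 0 < p <= 1 -> `|x| <= 1 / 2 ->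
  edge_cgf p (2 * x) + edge_cgf p (- (2 * x)) -
    4 * (edge_cgf p x + edge_cgf p (- x)) <= 16 * p * x ^+ 4.
Proof.
move=> p01 x2; have /andP[p0 p1] := p01.
have gt0 y := edge_mgf_gt0 y p01.
rewrite -ler_expR expRB expRD !expR_edge_cgf//.
rewrite expRM_natl expRD !expR_edge_cgf//.
rewrite ler_pdivrMr ?exprn_gt0 ?mulr_gt0//.
set e := expR x; have e0 : 0 < e by exact: expR_gt0.
pose h := (e + e^-1) / 2 - 1; pose q := 2 * p * (1 - p).
have h0 : 0 <= h.
  rewrite /h subr_ge0 ler_pdivlMr// mul1r.
  have -> : e + e^-1 = 2 + (e - 1) ^+ 2 / e by field; rewrite gt_eqF.
  by rewrite lerDl divr_ge0 ?sqr_ge0// ltW.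
have hx : h <= 2 * x ^+ 2.
  have := expR_le_quadratic x2.
  have := @expR_le_quadratic _ (- x); rewrite normrN => /(_ x2).
  rewrite expRN sqrrN -/e /h; lra.
have -> : edge_mgf p (2 * x) * edge_mgf p (- (2 * x)) = 1 + 4 * q * h + 2 * q * h ^+ 2.
  rewrite /edge_mgf expRN (_ : 2 * x = x + x); last by ring.
  by rewrite expRD -/e /q /h; field; rewrite gt_eqF.
have -> : edge_mgf p x * edge_mgf p (- x) = 1 + q * h.
  by rewrite /edge_mgf expRN -/e /q /h; field; rewrite gt_eqF.
have q0 : 0 <= q by rewrite /q !mulr_ge0 ?(ltW p0) ?subr_ge0.
have qp : q <= 2 * p by rewrite /q; nra.
have qh0 : 0 <= q * h by rewrite mulr_ge0.
(* By Bernoulli's inequality the fourth power absorbs [4 q h]. What remains is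
   [2 q h^2 <= 16 p x^4], from [q <= 2 p] and [h <= 2 x^2]. *)
apply: (@le_trans _ _ ((1 + 2 * q * h ^+ 2) * (1 + q * h) ^+ 4)).
  have b4 : 1 + 4 * (q * h) <= (1 + q * h) ^+ 4.
    rewrite [leRHS](_ : _ = 1 + 4 * (q * h) +
      (q * h) ^+ 2 * (6 + 4 * (q * h) + (q * h) ^+ 2)); last by ring.
    by rewrite lerDl mulr_ge0 ?exprn_ge0// !addr_ge0 ?exprn_ge0// mulr_ge0.
  have : 0 <= 2 * q * h ^+ 2 by rewrite mulr_ge0 ?sqr_ge0// mulr_ge0.
  nra.
rewrite ler_wpM2r ?exprn_ge0//; first lra.
apply: le_trans (expR_ge1Dx _); rewrite lerD2l.
have : h ^+ 2 <= 4 * x ^+ 4.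
  have -> : 4 * x ^+ 4 = (2 * x ^+ 2) ^+ 2 by ring.
  by rewrite lerXn2r// nnegrE mulr_ge0 ?sqr_ge0.
have := sqr_ge0 h.
nra.
Qed.

(** * Products of edge generating functions *)

Section product_formulas.
Variables (R : realType) (N : nat) (p gam : R).
Hypothesis p01 : 0 < p <= 1.
Implicit Types s t : {ffun 'I_N -> bool}.
Local Notation S s := (\sum_(i < N) spin R s i).
Local Notation L := (edge_cgf p).

Lemma sum2_affine (a b : R) (f : 'I_N -> R) :
  \sum_(i < N) \sum_(j < N) (a + b * (f i * f j)) =
  N%:R ^+ 2 * a + b * (\sum_(i < N) f i) ^+ 2.
Proof.
under eq_bigr do rewrite big_split/= -mulr_sumr -mulr_sumr sumr_const card_ord.
rewrite big_split/= sumr_const card_ord -mulr_sumr -mulr_suml.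
rewrite -(mulr_natl (a *+ N)) -(mulr_natl a); ring.
Qed.

(** Any function of a sign is affine in it. Applied to [L (gam x)] at [x = s_i s_j], this leaves
    only a constant and [S s ^ 2] after summation. *)
Lemma prod_edge_mgf1 s :
  \prod_(i < N) \prod_(j < N) edge_mgf p (gam * (spin R s i * spin R s j)) =
  expR (N%:R ^+ 2 * ((L gam + L (- gam)) / 2) + (L gam - L (- gam)) / 2 * S s ^+ 2).
Proof.
rewrite -sum2_affine expR_sum; apply: eq_bigr => i _.
rewrite expR_sum; apply: eq_bigr => j _.
rewrite -expR_edge_cgf//; congr expR; rewrite /spin.
by case: (s i); case: (s j); 
  rewrite /= ?expr0 ?expr1 ?(mulrN1, mulN1r, mul1r, mulr1, opprK); field.
Qed.

(** For signs [x] and [y], [L (gam (x + y)) = c0 + c1 (x + y) + c0 x y], because [L 0 = 0]. With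
    [x = s_i s_j] and [y = t_i t_j], the term [x y] sums to the squared overlap. *)
Lemma prod_edge_mgf2 s t :
  \prod_(i < N) \prod_(j < N)
    edge_mgf p (gam * (spin R s i * spin R s j + spin R t i * spin R t j)) =
  expR (N%:R ^+ 2 * ((L (2 * gam) + L (- (2 * gam))) / 4) +
        (L (2 * gam) - L (- (2 * gam))) / 4 * (S s ^+ 2 + S t ^+ 2) +
        (L (2 * gam) + L (- (2 * gam))) / 4 *
          (\sum_(i < N) spin R s i * spin R t i) ^+ 2).
Proof.
set c0 := (_ + _) / 4; set c1 := (_ - _) / 4.
transitivity (expR (\sum_(i < N) \sum_(j < N) (c0 + c1 * (spin R s i * spin R s j)) +
   \sum_(i < N) \sum_(j < N) (0 + c1 * (spin R t i * spin R t j)) +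
   \sum_(i < N) \sum_(j < N)
     (0 + c0 * ((spin R s i * spin R t i) * (spin R s j * spin R t j))))); last first.
  by rewrite !sum2_affine; congr expR; ring.
rewrite -!big_split expR_sum; apply: eq_bigr => i _.
rewrite -!big_split expR_sum; apply: eq_bigr => j _.
rewrite -expR_edge_cgf//; congr expR; rewrite /spin /c0 /c1.
have e2 : gam * (1 + 1) = 2 * gam by ring.
have e2' : gam * (-1 - 1) = - (2 * gam) by ring.
have e3 : gam * (1 - 1) = 0 by ring.
have e4 : gam * (-1 + 1) = 0 by ring.
by case: (s i); case: (s j); case: (t i); case: (t j);
  rewrite /= ?expr0 ?expr1 ?(mulrN1, mulN1r, mul1r, mulr1, opprK)
    ?e2 ?e2' ?e3 ?e4 ?edge_cgf0; field.
Qed.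

(** Pointwise multiplication by the fixed [t] is an involution of the configurations. *)
Lemma sum_overlap (F : R -> R) t :
  \sum_s F (\sum_(i < N) spin R s i * spin R t i) = \sum_s F (S s).
Proof.
pose x s := [ffun i => s i (+) t i].
have xK : involutive x by move=> s; apply/ffunP => i; rewrite !ffunE addbK.
rewrite [RHS](reindex_inj (inv_inj xK)); apply: eq_bigr => s _; congr F.
by apply: eq_bigr => i _; rewrite /spin ffunE signr_addb.
Qed.

End product_formulas.

(** * Functions of independent Bernoulli variables *)

(** The probability that exactly the indices in [J] take the value 1. *)
Definition bernoulli_weight (R : realType) (p : R) (I : finType) (J : {set I}) : R :=
  \prod_(i : I) (if i \in J then p else 1 - p).

Lemma bernoulli_weight_ge0 (R : realType) (p : R) (I : finType) (J : {set I}) :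
  0 <= p <= 1 -> 0 <= bernoulli_weight p J.
Proof.
move=> /andP[p0 p1]; apply: prodr_ge0 => i _.
by case: ifP; rewrite // subr_ge0.
Qed.

Lemma sum_bernoulli_weight (R : realType) (p : R) (I : finType) (f : I -> R -> R) :
  \sum_(J : {set I}) bernoulli_weight p J * \prod_i f i (i \in J)%:R =
  \prod_i ((1 - p) * f i 0 + p * f i 1).
Proof.
under [RHS]eq_bigr do rewrite addrC.
rewrite bigA_distr; apply: eq_bigr => J _; rewrite -big_split.
by apply: eq_bigr => i _; case: (i \in J).
Qed.

Section bernoulli_family.
Context (R : realType) (d : measure_display) (T : measurableType d).
Context (P : probability T R) (I : finType) (X : I -> {RV P >-> R}) (p : R).
Hypothesis X_indep : mutually_independent X.
Hypothesis X1 : forall i, P [set w | X i w = 1] = p%:E.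
Hypothesis X0 : forall i, P [set w | X i w = 0] = (1 - p)%:E.

Let mX1 i (x : R) : measurable (X i @^-1` [set x]).
Proof. by rewrite -[X in measurable X]setTI; exact: measurable_funPT. Qed.

Let atom (J : {set I}) : set T :=
  \bigcap_(i in [set` [set: I]%SET]) (X i @^-1` [set (i \in J)%:R]).

Let measurable_atom J : measurable (atom J).
Proof. by apply: fin_bigcap_measurable => // i _; exact: mX1. Qed.

Let P_atom J : P (atom J) = (bernoulli_weight p J)%:E.
Proof.
rewrite /atom X_indep// -prodEFin; apply: congr_big => //= i; first by rewrite inE.
by move=> _; case: (i \in J); [exact: X1|exact: X0].
Qed.

(** The masses at 0 and 1 add up to 1, so each variable is almost surely 0 or 1; finitely many null
    sets are discarded. *)
Let ae_atom : {ae P, forall w, exists J, atom J w}.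
Proof.
have X01 i : {ae P, forall w, X i w = 0 \/ X i w = 1}.
  exists (~` (X i @^-1` [set 0] `|` X i @^-1` [set 1])); split.
  - by apply: measurableC; apply: measurableU.
  - rewrite probability_setC; last exact: measurableU.
    have disj : X i @^-1` [set 0] `&` X i @^-1` [set 1] = set0.
      by rewrite -subset0 => w [/= -> /eqP]; rewrite eq_sym oner_eq0.
    have -> : P (X i @^-1` [set 0] `|` X i @^-1` [set 1]) = (1 - p + p)%:E.
      by rewrite measureU// EFinD; congr (_ + _)%E; [exact: X0|exact: X1].
    by rewrite subrK subee.
  - by move=> w /= + h; apply; case: h => ->; [left|right].
have : {ae P, forall w, forall i, X i w = 0 \/ X i w = 1} by exact: filter_forall.
apply: filterS => w Xw; exists [set i | X i w == 1]%SET => i _ /=.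
rewrite inE; case: (Xw i) => ->; last by rewrite eqxx.
by rewrite eq_sym oner_eq0.
Qed.

(** Almost surely the integrand is a simple function, constant on each of the disjoint events
    [atom J]. *)
Lemma integral_bernoulli (F : (I -> R) -> R) :
  (forall x, 0 <= F x) -> measurable_fun setT (fun w => F (fun i => X i w)) ->
  (\int[P]_w (F (fun i => X i w))%:E =
   (\sum_(J : {set I}) bernoulli_weight p J * F (fun i => (i \in J)%:R))%:E)%E.
Proof.
move=> F0 mF.
pose c (J : {set I}) := F (fun i => (i \in J)%:R).
transitivity (\int[P]_w (\sum_(J : {set I}) (c J * \1_(atom J) w)%:E))%E.
  apply: ge0_ae_eq_integral => //.
  - exact/measurable_EFinP.
  - apply: emeasurable_sum => J; apply/measurable_EFinP/measurable_funM => //.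
  - by move=> w _; rewrite lee_fin.
  - by move=> w _; apply: sume_ge0 => J _; rewrite lee_fin mulr_ge0 ?F0.
  - move: ae_atom; apply: filterS => w [J Jw] _.
    rewrite (bigD1 J)//= big1 ?adde0.
      rewrite indicE mem_set// mulr1; congr (F _)%:E; apply/funext => i.
      by apply: Jw => /=; rewrite inE.
    move=> K KJ; rewrite indicE memNset ?mulr0// => Kw.
    move/eqP: KJ; apply; apply/setP => i.
    have := Kw i (finset.in_setT i); rewrite /= (Jw i (finset.in_setT i)).
    by case: (i \in J); case: (i \in K) => // /eqP; rewrite ?oner_eq0// eq_sym oner_eq0.
rewrite ge0_integral_sum//; last 2 first.
- by move=> J; apply/measurable_EFinP/measurable_funM => //.
- by move=> J w _; rewrite lee_fin mulr_ge0 ?F0.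
rewrite -sumEFin; apply: eq_bigr => J _.
under eq_integral do rewrite EFinM.
rewrite ge0_integralZl_EFin//.
- rewrite integral_indic// setIT mulrC EFinM.
  by congr (_ * _)%E; exact: P_atom.
- exact/measurable_EFinP.
- exact: F0.
Qed.

End bernoulli_family.

(** * The second moment *)

Section second_moment.
Variables (R : realType) (N : nat) (p beta : R) (g : R -> R).
Hypothesis p01 : 0 < p <= 1.
Local Notation S s := (\sum_(i < N) spin R s i).
Local Notation L := (edge_cgf p).
Let gam : R := beta / (2 * N%:R * p).
Let a0 := (L gam + L (- gam)) / 2.
Let a1 := (L gam - L (- gam)) / 2.
Let c0 := (L (2 * gam) + L (- (2 * gam))) / 4.
Let c1 := (L (2 * gam) - L (- (2 * gam))) / 4.

Let Z (J : {set 'I_N * 'I_N}) : R :=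
  partition_function p beta g (fun i j => ((i, j) \in J)%:R).

(** The expected partition function without its factor [e^(N^2 a0)]. *)
Definition gibbs_mean : R := \sum_(s : {ffun 'I_N -> bool})
  expR (a1 * S s ^+ 2) * g (S s / Num.sqrt N%:R).

(** The second moment without the factor [e^(2 N^2 a0)], which is why the exponent contains
    [c0 - 2 a0]. *)
Definition gibbs_second : R :=
  \sum_(s : {ffun 'I_N -> bool}) \sum_(t : {ffun 'I_N -> bool})
  expR (N%:R ^+ 2 * (c0 - 2 * a0) + c1 * (S s ^+ 2 + S t ^+ 2) +
        c0 * (\sum_(i < N) spin R s i * spin R t i) ^+ 2) *
  (g (S s / Num.sqrt N%:R) * g (S t / Num.sqrt N%:R)).

Lemma expR_hamiltonian (J : {set 'I_N * 'I_N}) s :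
  expR (- beta * hamiltonian p (fun i j => ((i, j) \in J)%:R) s) =
  \prod_(ij : 'I_N * 'I_N)
    expR (gam * (ij \in J)%:R * (spin R s ij.1 * spin R s ij.2)).
Proof.
transitivity (\prod_i \prod_j
    expR (gam * ((i, j) \in J)%:R * (spin R s i * spin R s j))); last first.
  by rewrite pair_bigA; apply: eq_bigr => -[].
rewrite /hamiltonian mulrA mulrNN.
under [in RHS]eq_bigr do rewrite -expR_sum.
rewrite -expR_sum mulr_sumr; congr expR; apply: eq_bigr => i _.
rewrite mulr_sumr; apply: eq_bigr => j _.
by rewrite /gam; ring.
Qed.

Lemma mean_partition_function :
  \sum_(J : {set 'I_N * 'I_N}) bernoulli_weight p J * Z J =
  expR (N%:R ^+ 2 * a0) * gibbs_mean.
Proof.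
under eq_bigr do rewrite /Z /partition_function mulr_sumr.
rewrite exchange_big/= mulr_sumr; apply: eq_bigr => s _.
under eq_bigr do rewrite mulrA expR_hamiltonian.
rewrite -mulr_suml mulrA; congr (_ * _).
rewrite (sum_bernoulli_weight p
  (fun ij x => expR (gam * x * (spin R s ij.1 * spin R s ij.2)))).
rewrite -expRD -prod_edge_mgf1// pair_bigA/=.
by apply: eq_bigr => ij _; rewrite mulr0 mul0r expR0 !mulr1.
Qed.

Lemma second_moment_partition_function :
  \sum_(J : {set 'I_N * 'I_N}) bernoulli_weight p J * Z J ^+ 2 =
  expR (N%:R ^+ 2 * a0) ^+ 2 * gibbs_second.
Proof.
under eq_bigr do rewrite /Z /partition_function expr2 mulr_suml mulr_sumr.
rewrite exchange_big/= mulr_sumr; apply: eq_bigr => s _.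
under eq_bigr do rewrite mulr_sumr mulr_sumr.
rewrite exchange_big/= mulr_sumr; apply: eq_bigr => t _.
under eq_bigr do
  rewrite mulrACA (mulrA (bernoulli_weight _ _)) !expR_hamiltonian -big_split/=.
rewrite -mulr_suml mulrA; congr (_ * _).
rewrite (sum_bernoulli_weight p (fun ij x =>
   expR (gam * x * (spin R s ij.1 * spin R s ij.2)) *
   expR (gam * x * (spin R t ij.1 * spin R t ij.2)))).
rewrite -expRM_natl -expRD.
transitivity (expR (N%:R ^+ 2 * c0 + c1 * (S s ^+ 2 + S t ^+ 2) +
        c0 * (\sum_(i < N) spin R s i * spin R t i) ^+ 2)); last first.
  by congr expR; ring.
rewrite -prod_edge_mgf2// pair_bigA/=.
apply: eq_bigr => ij _; rewrite mulr0 !mul0r expR0 !mulr1 -expRD -mulrDr.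
by [].
Qed.

Variables (G eta eta0 theta : R).
Hypothesis (N0 : (0 < N)%N) (g0 : forall x, 0 <= g x) (gG : forall x, g x <= G).
Hypothesis (eta_gt0 : 0 < eta) (eta_le : eta <= eta0).
Hypothesis (theta_lt : theta < 1 / 2).
Hypothesis (a1_ge0 : 0 <= a1) (a1_le : N%:R * a1 + 4 * eta0 <= theta).
Hypothesis (D_le : N%:R ^+ 2 * (c0 - 2 * a0) <= eta).
Hypothesis (c1_le : N%:R * (c1 - a1) <= eta) (c0_le : N%:R * c0 <= eta).

Let NR0 : 0 < N%:R :> R. Proof. by rewrite ltr0n. Qed.
Let K := expR (theta / (1 - 2 * theta)).

(** This is [walk_exp_sqr] at [b = theta / N], where the exponent no longer depends on [N]. *)
Lemma sum_exp_sqr_le :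
  \sum_(s : {ffun 'I_N -> bool}) expR (theta / N%:R * S s ^+ 2) <= 2 ^+ N * K.
Proof.
have theta0 : 0 <= theta.
  have := mulr_ge0 (ltW NR0) a1_ge0; have := lt_le_trans eta_gt0 eta_le.
  by move: a1_le; lra.
rewrite (sum_spins_walk N (fun x => expR (theta / N%:R * x ^+ 2))).
have eN : N%:R * (theta / N%:R) = theta by rewrite mulrC divfK// gt_eqF.
have -> : K = expR (N%:R * (theta / N%:R) / (1 - 2 * N%:R * (theta / N%:R))).
  by rewrite -(mulrA 2) eN.
apply: walk_exp_sqr; first by rewrite divr_ge0.
by rewrite -(mulrA 2) eN; move: theta_lt; lra.
Qed.

(** Here [eta] is the small error, while [eta0] and [theta] stay fixed. The exponent exceeds
    [a1 (S1 + S2)] by at most [eta V], with [V = 1 + (S1 + S2) / N + S3 / N]; the resulting error is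
    linear in [eta] at the cost of a slightly larger exponential rate. *)
Lemma exp_increment_le (S1 S2 S3 : R) : 0 <= S1 -> 0 <= S2 -> 0 <= S3 ->
  expR (N%:R ^+ 2 * (c0 - 2 * a0) + c1 * (S1 + S2) + c0 * S3) <=
  expR (a1 * (S1 + S2)) + eta / eta0 * expR (2 * eta0) *
    (expR (theta / N%:R * S1) * expR (theta / N%:R * S2) + expR (theta / N%:R * S3)).
Proof.
have [NR eta1 eta2] := And3 NR0 eta_gt0 eta_le.
have [aN Dle c1le c0le] := And4 a1_le D_le c1_le c0_le.
move=> S10 S20 S30.
have eta00 : 0 < eta0 by exact: lt_le_trans eta_le.
pose u := (S1 + S2) / N%:R; pose v := S3 / N%:R.
have u0 : 0 <= u by rewrite divr_ge0// addr_ge0.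
have v0 : 0 <= v by rewrite divr_ge0.
have E12 : S1 + S2 = N%:R * u by rewrite /u; field; rewrite gt_eqF.
have E3 : S3 = N%:R * v by rewrite /v; field; rewrite gt_eqF.
rewrite -expRD -mulrDr E12 E3.
have -> : theta / N%:R * (N%:R * u) = theta * u by field; rewrite gt_eqF.
have -> : theta / N%:R * (N%:R * v) = theta * v by field; rewrite gt_eqF.
pose V := 1 + u + v.
have V0 : 0 < V by rewrite /V; lra.
apply: (@le_trans _ _ (expR (a1 * (N%:R * u) + eta * V))).
  by rewrite ler_expR /V; nra.
(* e^x - 1 <= x e^x for x = eta V, and V <= e^(eta0 V) / eta0 *)
have h1 : expR (eta * V) <= 1 + eta * V * expR (eta * V).
  have := expR_ge1Dx (- (eta * V)); rewrite expRN.
  have := expR_gt0 (eta * V); set e := expR _ => e0.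
  by move=> /(ler_wpM2r (ltW e0)); rewrite mulVf ?gt_eqF//; lra.
have h2 : eta * V * expR (eta * V) <= eta / eta0 * expR (2 * eta0 * V).
  have -> : 2 * eta0 * V = eta0 * V + eta0 * V by ring.
  rewrite expRD mulrA; apply: ler_pM; rewrite ?expR_ge0//.
  - by rewrite mulr_ge0// ltW.
  - rewrite -mulrA ler_pM2l// ler_pdivlMl//.
    by apply: le_trans (expR_ge1Dx _); lra.
  - by rewrite ler_expR ler_pM2r.
rewrite expRD.
apply: (@le_trans _ _ (expR (a1 * (N%:R * u)) * (1 + eta / eta0 * expR (2 * eta0 * V)))).
  by rewrite ler_pM2l ?expR_gt0// (le_trans h1)// lerD2l.
rewrite mulrDr mulr1 lerD2l mulrCA -[leRHS]mulrA ler_pM2l ?divr_gt0//.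
have -> : 2 * eta0 * V = 2 * eta0 + (2 * eta0 * u + 2 * eta0 * v) by rewrite /V; ring.
rewrite (expRD (2 * eta0)) mulrCA ler_pM2l ?expR_gt0// -expRD.
have t2 : 0 <= theta - 2 * eta0.
  by have := mulr_ge0 (ltW NR) a1_ge0; lra.
have h3 : 0 <= (theta - 4 * eta0 - N%:R * a1) * u by rewrite mulr_ge0//; lra.
(* The exponent is at most [theta] times the larger of [u] and [v]; the slack [4 eta0] in [a1_le] is
   what this needs. Bounding by the sum of the two exponentials decouples the overlap from the total
   spins. *)
have [uv|/ltW vu] := leP u v.
  have h4 : 0 <= (theta - 2 * eta0) * (v - u) by rewrite mulr_ge0// subr_ge0.
  apply: (@le_trans _ _ (expR (theta * v))); last by rewrite lerDr expR_ge0.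
  by rewrite ler_expR; lra.
have h4 : 0 <= eta0 * (u - v) by rewrite mulr_ge0 ?(ltW eta00)// subr_ge0.
apply: (@le_trans _ _ (expR (theta * u))); last by rewrite lerDl expR_ge0.
by rewrite ler_expR; lra.
Qed.

(** Summing [exp_increment_le] over pairs, the main term factorizes into [gibbs_mean ^ 2]. The error
    terms give [(2^N K)^2] and, through [sum_overlap] for each of the [2^N] values of [t],
    [4^N K]. *)
Lemma gibbs_second_le :
  gibbs_second <= gibbs_mean ^+ 2 +
    G ^+ 2 * (eta / eta0 * expR (2 * eta0)) * (4 ^+ N * (K ^+ 2 + K)).
Proof.
have eta00 : 0 < eta0 by exact: lt_le_trans eta_le.
set B := eta / eta0 * _.
have B0 : 0 <= B by rewrite mulr_ge0 ?expR_ge0// divr_ge0 ?ltW.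
pose E s := expR (theta / N%:R * S s ^+ 2).
pose E2 s t := expR (theta / N%:R * (\sum_(i < N) spin R s i * spin R t i) ^+ 2).
pose q s := g (S s / Num.sqrt N%:R).
have q0 s : 0 <= q s by exact: g0.
have qG s : q s <= G by exact: gG.
apply: (@le_trans _ _ (\sum_s \sum_t
   (expR (a1 * S s ^+ 2) * q s * (expR (a1 * S t ^+ 2) * q t) +
    G ^+ 2 * B * (E s * E t + E2 s t)))).
  apply: ler_sum => s _; apply: ler_sum => t _.
  apply: (@le_trans _ _
    ((expR (a1 * (S s ^+ 2 + S t ^+ 2)) + B * (E s * E t + E2 s t)) * (q s * q t))).
    rewrite ler_wpM2r ?mulr_ge0//.
    by apply: exp_increment_le; rewrite sqr_ge0.
  rewrite mulrDl; apply: lerD.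
    by rewrite mulrDr expRD mulrACA.
  rewrite mulrC mulrA ler_wpM2r ?addr_ge0 ?mulr_ge0 ?expR_ge0//.
  rewrite ler_wpM2r// expr2; apply: ler_pM => //.
rewrite (_ : \sum_s _ = gibbs_mean ^+ 2 +
  G ^+ 2 * B * ((\sum_s E s) ^+ 2 + \sum_t \sum_s E2 s t)).
  rewrite lerD2l; apply: ler_wpM2l; first exact: mulr_ge0 (sqr_ge0 G) B0.
  have X0 : 0 <= \sum_s E s by apply: sumr_ge0 => s _; exact: expR_ge0.
  have XK : \sum_s E s <= 2 ^+ N * K by exact: sum_exp_sqr_le.
  rewrite mulrDr; apply: lerD.
    rewrite (_ : 4 = 2 ^+ 2 :> R); last by ring.
    by rewrite -exprM mulnC exprM -exprMn lerXn2r// nnegrE ?mulr_ge0 ?expR_ge0 ?exprn_ge0.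
  apply: (@le_trans _ _ (\sum_(t : {ffun 'I_N -> bool}) 2 ^+ N * K)).
    apply: ler_sum => t _; rewrite (sum_overlap (fun x => expR (theta / N%:R * x ^+ 2)) t).
    exact: XK.
  rewrite sumr_const card_ffun card_bool card_ord -[leLHS]mulr_natl natrX mulrA.
  by rewrite -exprMn -natrM.
rewrite [in RHS]exchange_big/= /gibbs_mean expr2.
under eq_bigr do rewrite big_split/= -mulr_sumr -mulr_sumr big_split/= -mulr_sumr.
by rewrite big_split/= -mulr_suml -mulr_sumr big_split/= -mulr_suml expr2.
Qed.

End second_moment.

(** * Asymptotics of the parameters and of the moments *)

(** Put [k = p^3 N^2]. As [2 N p gam = beta < 1], one has [4 k gam^2 <= 1]. The three lower bounds
    on [k] yield, in order, [gam <= 1/4], [3 gam <= eta], and the bound on [N^2 (c0 - 2 a0)], which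
    is at most [1 / (4 k)]. *)
Lemma cgf_parameters (R : realType) (N : nat) (p beta eta : R) :
  (0 < N)%N -> 0 < p <= 1 -> 0 < beta < 1 -> 0 < eta ->
  4 <= p ^+ 3 * N%:R ^+ 2 -> 9 / (4 * eta ^+ 2) <= p ^+ 3 * N%:R ^+ 2 ->
  1 / (4 * eta) <= p ^+ 3 * N%:R ^+ 2 ->
  let gam := beta / (2 * N%:R * p) in
  let L := edge_cgf p in
  let a0 := (L gam + L (- gam)) / 2 in
  let a1 := (L gam - L (- gam)) / 2 in
  let c0 := (L (2 * gam) + L (- (2 * gam))) / 4 in
  let c1 := (L (2 * gam) - L (- (2 * gam))) / 4 in
  [/\ 0 <= a1, N%:R * a1 <= beta / 2 + eta,
      N%:R ^+ 2 * (c0 - 2 * a0) <= eta,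
      N%:R * (c1 - a1) <= eta & N%:R * c0 <= eta].
Proof.
move=> N0 p01 /andP[b0 b1] e0; set k := p ^+ 3 * _ => k4 k9 k1 gam L a0 a1 c0 c1.
have /andP[p0 p1] := p01.
have NR0 : 0 < N%:R :> R by rewrite ltr0n.
have gam0 : 0 < gam by rewrite divr_gt0// !mulr_gt0.
have Npg : 2 * N%:R * p * gam = beta by rewrite /gam; field; rewrite !gt_eqF.
have k0 : 0 < k by rewrite mulr_gt0 ?exprn_gt0.
have gk : 4 * k * gam ^+ 2 <= 1.
  have -> : 4 * k * gam ^+ 2 = p * (2 * N%:R * p * gam) ^+ 2 by rewrite /k; ring.
  rewrite Npg; have : beta ^+ 2 <= 1 by rewrite expr_le1// ltW.
  have := sqr_ge0 beta; nra.
have gam_ge0 := ltW gam0; have eta_ge0 := ltW e0.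
have gg := sqr_ge0 gam.
have g14 : gam <= 1 / 4.
  have : gam ^+ 2 <= (1 / 4) ^+ 2.
    have : 0 <= (k - 4) * gam ^+ 2 by rewrite mulr_ge0// subr_ge0.
    lra.
  by rewrite ler_pXn2r// nnegrE; lra.
have g3 : 3 * gam <= eta.
  have : (3 * gam) ^+ 2 <= eta ^+ 2.
    move: k9; rewrite ler_pdivrMr ?mulr_gt0 ?exprn_gt0// => k9.
    rewrite -(ler_pM2l k0) exprMn; lra.
  by rewrite ler_pXn2r// nnegrE mulr_ge0.
have gn : `|gam| <= 1 / 2 by rewrite ger0_norm ?ltW//; lra.
have gn' : `|- gam| <= 1 / 2 by rewrite normrN.
have g2n : `|2 * gam| <= 1 / 2 by rewrite ger0_norm; lra.
have g2n' : `|- (2 * gam)| <= 1 / 2 by rewrite normrN.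
have u1 := edge_cgf_le p01 gn; have u1' := edge_cgf_le p01 gn'.
have l1 := edge_cgf_ge p01 gn; have l1' := edge_cgf_ge p01 gn'.
have u2 := edge_cgf_le p01 g2n; have u2' := edge_cgf_le p01 g2n'.
have l2 := edge_cgf_ge p01 g2n; have l2' := edge_cgf_ge p01 g2n'.
have Npg2 : N%:R * (p * gam ^+ 2) <= gam / 2.
  have -> : N%:R * (p * gam ^+ 2) = (2 * N%:R * p * gam) * gam / 2 by field.
  by rewrite Npg ler_pM2r// ler_piMl ?ltW.
split.
- by rewrite divr_ge0// edge_cgfB_ge0.
- apply: (@le_trans _ _ (N%:R * (p * gam + 2 * (p * gam ^+ 2)))).
    by rewrite ler_pM2l// /a1; move: u1 l1'; rewrite -/L; lra.
  rewrite mulrDr; lra.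
- have := edge_cgf_cancel p01 gn; rewrite -/L => cc.
  apply: (@le_trans _ _ (N%:R ^+ 2 * (4 * p * gam ^+ 4))).
    by rewrite ler_pM2l ?exprn_gt0// /c0 /a0; lra.
  rewrite -(ler_pM2l k0).
  have -> : k * (N%:R ^+ 2 * (4 * p * gam ^+ 4)) = (2 * N%:R * p * gam) ^+ 4 / 4.
    by rewrite /k; field.
  rewrite Npg; have : beta ^+ 4 <= 1 by rewrite expr_le1// ltW.
  have : 1 <= k * (4 * eta) by rewrite -ler_pdivrMr ?mulr_gt0.
  lra.
- apply: (@le_trans _ _ (N%:R * (6 * (p * gam ^+ 2)))).
    rewrite ler_pM2l// /c1 /a1; move: u1 l1 u1' l1' u2 l2 u2' l2'; rewrite -/L.
    lra.
  lra.
- apply: (@le_trans _ _ (N%:R * (4 * (p * gam ^+ 2)))).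
    rewrite ler_pM2l// /c0; move: u2 l2 u2' l2'; rewrite -/L.
    by rewrite !sqrrN exprMn; lra.
  lra.
Qed.

(** Since [a1 >= 0] the exponential weights are at least 1, so only configurations with [S / sqrt N]
    in [[u, v]] are kept. *)
Lemma gibbs_mean_ge (R : realType) (N : nat) (p beta : R) (g : R -> R) (u v C delta : R) :
  (0 < N)%N -> 0 < p <= 1 -> 0 <= beta -> (forall x, 0 <= g x) ->
  (forall x, u <= x <= v -> delta <= g x) -> 0 <= delta ->
  2 <= C -> `|u| <= C -> `|v| <= C ->
  4 * C <= Num.sqrt N%:R -> 4 <= (v - u) * Num.sqrt N%:R ->
  delta * (3 * (v - u) / (32 * expR (4 * C ^+ 2) * C)) * 2 ^+ N <=
  gibbs_mean N p beta g.
Proof.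
move=> N0 p01 b0 g0 gd d0 C2 uC vC qC uvq.
have p0 : 0 < p by case/andP: p01.
rewrite -mulrA.
apply: le_trans (ler_wpM2l d0 (sum_spins_window_ge C2 uC vC qC uvq)) _.
rewrite mulr_sumr; apply: ler_sum => s _.
apply: (@le_trans _ _ (g ((\sum_(i < N) spin R s i) / Num.sqrt N%:R))).
  by case: ifP => [/gd|_]; rewrite ?mulr1 ?mulr0.
rewrite ler_peMl// -[leLHS]expR0 ler_expR mulr_ge0 ?sqr_ge0//.
rewrite divr_ge0// edge_cgfB_ge0// divr_ge0// !mulr_ge0// ltW//.
Qed.

Lemma gibbs_second_near (R : realType) (beta : R) (p : nat -> R) (g : R -> R) :
  0 < beta < 1 -> (forall N, (0 < N)%N -> 0 < p N <= 1) ->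
  p N ^+ 3 * N%:R ^+ 2 @[N --> \oo] --> +oo ->
  continuous g -> bounded_fun g -> (forall x, 0 <= g x) -> (exists x, g x != 0) ->
  forall e, 0 < e -> \forall N \near \oo,
    [/\ (0 < N)%N, 0 < gibbs_mean N (p N) beta g &
      gibbs_second N (p N) beta g <= (1 + e) * gibbs_mean N (p N) beta g ^+ 2].
Proof.
move=> b01 p01 pN gc gb g0 [x0 gx0] e e0.
have /andP[b0 b1] := b01.
have gx0_gt0 : 0 < g x0 by rewrite lt_neqAle eq_sym gx0 g0.
pose delta := g x0 / 2.
have d0 : 0 < delta by rewrite divr_gt0.
have [r /= r0 rg] : exists2 r : R, 0 < r & forall x, `|x0 - x| < r -> delta <= g x.
  have /cvgrPdist_lt/(_ _ d0)/nbhs_ballP[r /= r0 rg] := gc x0.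
  exists r => // x xr; have := rg x xr; rewrite /= ltr_norml /delta; lra.
(* Half the radius keeps the closed interval inside the open ball. *)
pose u := x0 - r / 2; pose v := x0 + r / 2.
have gd x : u <= x <= v -> delta <= g x.
  by rewrite /u /v => /andP[ux xv]; apply: rg; rewrite ltr_norml; apply/andP; split; lra.
have [G G0 gG] : exists2 G, 0 < G & forall x, g x <= G.
  have [G G0 gG] := pinfty_ex_gt0 gb.
  by exists G => // x; apply: le_trans (gG x _) => //; rewrite ler_norm.
pose C := `|u| + `|v| + 2.
have C2 : 2 <= C by rewrite lerDr addr_ge0.
have uC : `|u| <= C by rewrite /C -addrA lerDl addr_ge0.
have vC : `|v| <= C by rewrite /C addrAC lerDr addr_ge0.
pose m := delta * (3 * (v - u) / (32 * expR (4 * C ^+ 2) * C)).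
have uv : 0 < v - u by rewrite /u /v; lra.
have m0 : 0 < m.
  by rewrite mulr_gt0 ?divr_gt0 ?mulr_gt0 ?expR_gt0//; lra.
(* The 5 is 4 from the slack in [gibbs_second_le] plus 1 for [eta <= eta0]; then
   [theta = (1 + beta) / 4 < 1 / 2]. *)
pose eta0 := (1 - beta) / 20; pose theta := beta / 2 + 5 * eta0.
have eta00 : 0 < eta0 by rewrite divr_gt0// subr_gt0.
have theta12 : theta < 1 / 2 by rewrite /theta /eta0; lra.
pose K := expR (theta / (1 - 2 * theta)).
have K0 : 0 < K by exact: expR_gt0.
pose M := G ^+ 2 * (expR (2 * eta0) / eta0) * (K ^+ 2 + K).
have M0 : 0 < M.
  by rewrite !mulr_gt0 ?invr_gt0 ?expR_gt0 ?exprn_gt0// addr_gt0 ?exprn_gt0.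
(* The error in [gibbs_second_le] is [M eta 4^N], to be compared with [e (m 2^N)^2], where [m 2^N]
   bounds the mean from below. *)
pose eta := Num.min eta0 (e * m ^+ 2 / M).
have eta_gt0 : 0 < eta by rewrite lt_min eta00 divr_gt0// mulr_gt0 ?exprn_gt0.
have eta_le : eta <= eta0 by rewrite ge_min lexx.
have etaM : M * eta <= e * m ^+ 2.
  by rewrite mulrC -ler_pdivlMr// ge_min lexx orbT.
have /cvgryPge pNge := pN.
near=> N.
have N0 : (0 < N)%N by near: N; exact: nbhs_infty_gt.
have pN01 := p01 N N0.
have k4 : 4 <= p N ^+ 3 * N%:R ^+ 2 by near: N; exact: pNge.
have k9 : 9 / (4 * eta ^+ 2) <= p N ^+ 3 * N%:R ^+ 2 by near: N; exact: pNge.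
have k1 : 1 / (4 * eta) <= p N ^+ 3 * N%:R ^+ 2 by near: N; exact: pNge.
have Q : 4 * C + 4 / (v - u) <= Num.sqrt N%:R.
  rewrite -[leLHS]ger0_norm; last by rewrite addr_ge0 ?divr_ge0 ?mulr_ge0 ?ltW//; lra.
  rewrite -sqrtr_sqr ler_sqrt//; apply: ltW.
  by near: N; exact: nbhs_infty_gtr.
have Q1 : 4 * C <= Num.sqrt N%:R.
  by apply: le_trans Q; rewrite lerDl divr_ge0 ?ltW.
have Q2 : 4 <= (v - u) * Num.sqrt N%:R.
  rewrite mulrC -ler_pdivrMr//; apply: le_trans Q; rewrite lerDr mulr_ge0//; lra.
have [a1_ge0 a1_le D_le c1_le c0_le] := cgf_parameters N0 pN01 b01 eta_gt0 k4 k9 k1.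
have mean_ge := gibbs_mean_ge N0 pN01 (ltW b0) g0 gd (ltW d0) C2 uC vC Q1 Q2.
rewrite -/m in mean_ge.
have mean_gt0 : 0 < gibbs_mean N (p N) beta g.
  by apply: lt_le_trans mean_ge; rewrite mulr_gt0 ?exprn_gt0.
split => //.
apply: le_trans (gibbs_second_le N0 g0 gG eta_gt0 eta_le theta12 a1_ge0 _
  D_le c1_le c0_le) _.
  by rewrite /theta; lra.
rewrite [leRHS]mulrDl mul1r lerD2l -/K.
apply: (@le_trans _ _ (e * (m * 2 ^+ N) ^+ 2)); last first.
  by rewrite ler_pM2l// lerXn2r// nnegrE ?(ltW mean_gt0)// (mulr_ge0 (ltW m0))// exprn_ge0.
have -> : e * (m * 2 ^+ N) ^+ 2 = e * m ^+ 2 * 4 ^+ N.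
  by rewrite exprMn mulrA; congr (_ * _);
    rewrite -exprM mulnC exprM; congr (_ ^+ _); ring.
rewrite [leLHS](_ : _ = M * eta * 4 ^+ N); last by rewrite /M; ring.
by rewrite ler_wpM2r// exprn_ge0.
Unshelve. all: by end_near. Qed.

(** * Moments and deviations for one random graph *)

Section one_graph.
Context (R : realType) (d : measure_display) (T : measurableType d).
Context (P : probability T R) (N : nat) (p beta : R) (g : R -> R).
Context (eps : 'I_N -> 'I_N -> {RV P >-> R}).
Hypothesis eps_indep :
  mutually_independent (fun ij : 'I_N * 'I_N => eps ij.1 ij.2).
Hypothesis eps1 : forall i j, P [set w | eps i j w = 1] = p%:E.
Hypothesis eps0 : forall i j, P [set w | eps i j w = 0] = (1 - p)%:E.
Hypothesis g0 : forall x, 0 <= g x.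

Let Z (w : T) : R := partition_function p beta g (fun i j => eps i j w).
Let ZJ (J : {set 'I_N * 'I_N}) : R :=
  partition_function p beta g (fun i j => ((i, j) \in J)%:R).

Lemma measurable_partition_function : measurable_fun setT Z.
Proof.
apply: measurable_sum => s; apply: measurable_funM => //.
apply: measurableT_comp => //.
apply: measurable_funM => //; apply: measurable_funM => //.
apply: measurable_sum => i; apply: measurable_sum => j.
by apply: measurable_funM => //; apply: measurable_funM.
Qed.

Lemma integral_partition_function (f : R -> R) :
  (forall x, 0 <= f x) -> measurable_fun setT f ->
  (\int[P]_w (f (Z w))%:E =
   (\sum_(J : {set 'I_N * 'I_N}) bernoulli_weight p J * f (ZJ J))%:E)%E.
Proof.
move=> f0 mf.
pose F (x : 'I_N * 'I_N -> R) := f (partition_function p beta g (fun i j => x (i, j))).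
apply: (integral_bernoulli eps_indep (fun ij => eps1 ij.1 ij.2)
  (fun ij => eps0 ij.1 ij.2) (F := F)) => //.
- by move=> x; exact: f0.
- exact: (measurableT_comp mf measurable_partition_function).
Qed.

Let meanZ := \sum_(J : {set 'I_N * 'I_N}) bernoulli_weight p J * ZJ J.

Lemma expectation_partition_function : fine ('E_P[Z]) = meanZ.
Proof.
rewrite unlock.
have Z0 w : 0 <= Z w.
  by apply: sumr_ge0 => s _; rewrite mulr_ge0 ?expR_ge0.
(* The integral formula asks for a function non-negative on the whole line, so the identity is
   replaced by the absolute value. *)
under eq_integral do rewrite -[Z _](ger0_norm (Z0 _)).
rewrite (integral_partition_function (f := fun x => `|x|))//.
rewrite /=; apply: eq_bigr => J _; rewrite ger0_norm//.
by apply: sumr_ge0 => s _; rewrite mulr_ge0 ?expR_ge0.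
Qed.

Definition relative_variance : R :=
  \sum_(J : {set 'I_N * 'I_N}) bernoulli_weight p J * (ZJ J / meanZ - 1) ^+ 2.

Let ratio w := Z w / fine ('E_P[Z]).

Lemma measurable_ratio : measurable_fun setT ratio.
Proof. by apply: measurable_funM => //; exact: measurable_partition_function. Qed.

Lemma integral_ratio_sqr (c : R) :
  (\int[P]_w ((ratio w - c) ^+ 2)%:E =
  (\sum_(J : {set 'I_N * 'I_N}) bernoulli_weight p J * (ZJ J / meanZ - c) ^+ 2)%:E)%E.
Proof.
rewrite -(integral_partition_function (f := fun x => (x / meanZ - c) ^+ 2)).
- by apply: eq_integral => w _; rewrite /ratio expectation_partition_function.
- by move=> x; exact: sqr_ge0.
- by apply: measurable_funX; apply: measurable_funB => //; apply: measurable_funM.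
Qed.

Lemma Lnorm2_ratio (c : R) :
  Lnorm P 2%:E (fun w => (ratio w - c)%:E) =
  (Num.sqrt (\sum_(J : {set 'I_N * 'I_N})
    bernoulli_weight p J * (ZJ J / meanZ - c) ^+ 2))%:E.
Proof.
rewrite unlock.
under eq_integral => w _.
  rewrite abse_EFin poweR_EFin (powR_mulrn 2)// real_normK ?num_real//.
  over.
(* Non-negativity of the sum is read off the integral: [p] is not confined to [[0, 1]] here, so the
   weights carry no sign a priori. *)
rewrite /= integral_ratio_sqr poweR_EFin powR12_sqrt// -lee_fin -integral_ratio_sqr.
by apply: integral_ge0 => w _; rewrite lee_fin sqr_ge0.
Qed.

Lemma Lfun2_ratio : ratio \in Lfun P 2%:E.
Proof.
rewrite inE/=; apply/andP; split; rewrite inE/=.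
  exact: measurable_ratio.
rewrite /finite_norm (_ : EFin \o ratio = fun w => (ratio w - 0)%:E); last first.
  by apply/funext => w; rewrite /= subr0.
by rewrite Lnorm2_ratio ltry.
Qed.

Lemma ratio_chebyshev (delta : R) : 0 < delta ->
  (P [set w | (delta < `|ratio w - 1|)%R] <= (relative_variance / delta ^+ 2)%:E)%E.
Proof.
move=> delta0.
set A := [set w | _].
have mA : measurable A.
  have mX : measurable_fun setT (fun w => `|ratio w - 1|).
    apply: measurableT_comp => //; apply: measurable_funB => //.
    exact: measurable_ratio.
  have := mX measurableT _ (measurable_itv `]delta, +oo[).
  rewrite setTI; congr measurable; apply/seteqP.
  by split=> w /=; rewrite in_itv/= andbT.
rewrite -[A]setIT -integral_indic// -/relative_variance.
have -> : (relative_variance / delta ^+ 2)%:E =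
    (\int[P]_w ((delta ^+ 2)^-1 * (ratio w - 1) ^+ 2)%:E)%E.
  under eq_integral do rewrite EFinM.
  rewrite ge0_integralZl_EFin//.
  - by rewrite integral_ratio_sqr -EFinM mulrC.
  - by move=> w _; rewrite lee_fin sqr_ge0.
  - apply/measurable_EFinP; apply: measurable_funX; apply: measurable_funB => //.
    exact: measurable_ratio.
  - by rewrite invr_ge0 exprn_ge0// ltW.
apply: ge0_le_integral => //.
- exact/measurable_EFinP.
- apply/measurable_EFinP; apply: measurable_funM => //.
  apply: measurable_funX; apply: measurable_funB => //.
  exact: measurable_ratio.
- move=> w _; rewrite lee_fin indicE; case: (boolP (w \in A)) => [|_] /=; last first.
    by rewrite mulr_ge0 ?sqr_ge0// invr_ge0 sqr_ge0.
  rewrite inE /A/= => dw.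
  rewrite ler_pdivlMl ?exprn_gt0// mulr1 -[leRHS]real_normK ?num_real//.
  by rewrite lerXn2r ?nnegrE// ltW.
Qed.

(** The relative variance is [E Z^2 / (E Z)^2 - 1], and the factor [e^(N^2 a0)] cancels in the
    quotient. *)
Lemma relative_variance_le (e : R) : 0 < p <= 1 ->
  0 < gibbs_mean N p beta g ->
  gibbs_second N p beta g <= (1 + e) * gibbs_mean N p beta g ^+ 2 ->
  relative_variance <= e.
Proof.
move=> p01 gm0 gs.
have sw : \sum_(J : {set 'I_N * 'I_N}) bernoulli_weight p J = 1.
  transitivity (\sum_(J : {set 'I_N * 'I_N})
      bernoulli_weight p J * \prod_(i : 'I_N * 'I_N) 1).
    by apply: eq_bigr => J _; rewrite big1 ?mulr1.
  rewrite (sum_bernoulli_weight p (fun (_ : 'I_N * 'I_N) (_ : R) => 1)) big1// => ij _.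
  by rewrite !mulr1 subrK.
have m0 : 0 < meanZ by rewrite /meanZ mean_partition_function// mulr_gt0 ?expR_gt0.
have -> : relative_variance =
    (\sum_(J : {set 'I_N * 'I_N}) bernoulli_weight p J * ZJ J ^+ 2) / meanZ ^+ 2 - 1.
  transitivity (\sum_(J : {set 'I_N * 'I_N}) (bernoulli_weight p J * ZJ J ^+ 2 / meanZ ^+ 2
     - 2 / meanZ * (bernoulli_weight p J * ZJ J) + bernoulli_weight p J)).
    by apply: eq_bigr => J _; field; rewrite gt_eqF.
  rewrite big_split/= sw sumrB -mulr_suml -mulr_sumr -/meanZ.
  by rewrite divfK ?gt_eqF//; ring.
rewrite second_moment_partition_function// /meanZ mean_partition_function//.
rewrite exprMn -mulf_div divff ?mul1r ?expf_neq0 ?gt_eqF ?expR_gt0//.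
by rewrite lerBlDl ler_pdivrMr ?exprn_gt0.
Qed.

End one_graph.
Theorem theorem1p2 (R : realType) (beta : R) (hbeta : 0 < beta < 1)
    (p : nat -> R) (hp : forall N, (0 < N)%N -> 0 < p N <= 1)
    (hpN : p N ^+ 3 * N%:R ^+ 2 @[N --> \oo] --> +oo)
    (d : nat -> measure_display) (T : forall N : nat, measurableType (d N))
    (P : forall N : nat, probability (T N) R)
    (eps : forall N : nat, 'I_N -> 'I_N -> {RV (P N) >-> R})
    (eps_indep : forall N : nat,
       mutually_independent (fun ij : 'I_N * 'I_N => eps N ij.1 ij.2))
    (eps1 : forall (N : nat) (i j : 'I_N),
       P N [set w | eps N i j w = 1] = (p N)%:E)
    (eps0 : forall (N : nat) (i j : 'I_N),
       P N [set w | eps N i j w = 0] = (1 - p N)%:E)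
    (g : R -> R) (g_cont : continuous g) (g_bounded : bounded_fun g)
    (g_ge0 : forall x, 0 <= g x) (g_neq0 : exists x, g x != 0) :
  let Z (N : nat) (w : T N) : R :=
    partition_function (p N) beta g (fun i j => eps N i j w) in
  let ratio (N : nat) (w : T N) : R := Z N w / fine ('E_(P N)[Z N]) in
  cvg_in_L2 P ratio 1 /\ cvg_in_probability P ratio 1.
Proof.
move=> Z ratio.
(* Both modes of convergence reduce to [V N -> 0]: the L2 distance to 1 is [sqrt (V N)], and
   Chebyshev bounds the deviation probability by [V N / delta^2]. *)
pose V N : R := relative_variance N (p N) beta g.
have V0 : V N @[N --> \oo] --> 0.
  apply/cvgr0Pnorm_le => e e0.
  have := gibbs_second_near hbeta hp hpN g_cont g_bounded g_ge0 g_neq0 e0.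
  apply: filterS => N [N0 gm gs]; have pN := hp N N0.
  rewrite ger0_norm; first exact: relative_variance_le pN gm gs.
  apply: sumr_ge0 => J _; rewrite mulr_ge0 ?sqr_ge0//.
  by apply: bernoulli_weight_ge0; case/andP: pN => /ltW -> ->.
split; split.
- by move=> N; exact: (Lfun2_ratio beta (@eps_indep N) (@eps1 N) (@eps0 N) g_ge0).
- rewrite (_ : (fun N => _) = (fun N => (Num.sqrt (V N))%:E)); last first.
    apply/funext => N.
    exact: (Lnorm2_ratio beta (@eps_indep N) (@eps1 N) (@eps0 N) g_ge0 1).
  apply: cvg_EFin; first by apply: nearW.
  rewrite -sqrtr0; apply: continuous_cvg => //; exact: sqrt_continuous.
- by move=> N; exact: measurable_ratio.
- move=> delta delta0.
  apply: (@squeeze_cvge _ _ _ _ (fun=> 0%E) _ (fun N => (V N / delta ^+ 2)%:E)).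
  + apply: nearW => N; rewrite measure_ge0/=.
    exact: (ratio_chebyshev beta (@eps_indep N) (@eps1 N) (@eps0 N) g_ge0 delta0).
  + exact: cvg_cst.
  + apply: cvg_EFin; first by apply: nearW.
    by rewrite -(mul0r (delta ^+ 2)^-1); apply: cvgMl.
Qed.
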